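(* Let $V$ be a multiplicative partial isometry (MPI) on a finite dimensional Hilbert space $\mathcal H$, with right leg $A$, left leg $\hat A$ and coproducts $\Delta$ on $A$, $\hat\Delta$ on $\hat A$. Then $(A,\Delta)$ and $(\hat A,\hat\Delta)$ are weak bialgebras (in duality with respect to the canonical pairing) if and only if $V$ is unital.
   Context: $\mathcal H$ is a finite dimensional complex Hilbert space, $\mathcal L(\mathcal H)$ the algebra of linear operators on $\mathcal H$, $\mathcal L(\mathcal H)_*$ the space of linear functionals on $\mathcal L(\mathcal H)$. Leg notation: $V_{ij}$ acts as $V$ on the $i$-th and $j$-th tensor factors of $\mathcal H\otimes\mathcal H\otimes\mathcal H$ and as the identity on the remaining one. A multiplicative partial isometry (MPI) on $\mathcal H$ is an operator $V\in\mathcal L(\mathcal H\otimes\mathcal H)$ with $VV^*V=V$ and $$V_{23}V_{12}=V_{12}V_{13}V_{23},\quad V_{13}V_{23}V_{23}^*=V_{12}^*V_{12}V_{13},\quad V_{12}V_{12}^*V_{23}=V_{23}V_{12}V_{12}^*,\quad V_{12}V_{23}^*V_{23}=V_{23}^*V_{23}V_{12}.$$ Put $\lambda(\omega)=(\omega\otimes\mathrm{id})(V)$ and $\rho(\omega)=(\mathrm{id}\otimes\omega)(V)$ for $\omega\in\mathcal L(\mathcal H)_*$. The right leg of $V$ is $A=\lambda(\mathcal L(\mathcal H)_* )$, the left leg is $\hat A=\rho(\mathcal L(\mathcal H)_* )$; both are subalgebras of $\mathcal L(\mathcal H)$ (not assumed to contain $\mathrm{id}_{\mathcal H}$). They are in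 duality under the non-degenerate pairing $\langle\lambda(\omega),\rho(\omega')\rangle=(\omega\otimes\omega')(V)$. The maps $\Delta(X)=V(X\otimes\mathrm{id})V^*$ and $\hat\Delta(X)=V^*(\mathrm{id}\otimes X)V$ restrict to coassociative algebra maps $\Delta\colon A\to A\otimes A$, $\hat\Delta\colon\hat A\to\hat A\otimes\hat A$, which are the transposes under the pairing of the multiplications of $\hat A$ and $A$, respectively. $V$ is unital if there exist $\varepsilon,\hat\varepsilon\in\mathcal L(\mathcal H)_*$ such that $\mathbf 1:=\lambda(\hat\varepsilon)\in A$ and $\hat{\mathbf 1}:=\rho(\varepsilon)\in\hat A$ are two-sided units for the algebras $A$ and $\hat A$, respectively. In that case the restrictions of $\varepsilon$ to $A$ and of $\hat\varepsilon$ to $\hat A$ are uniquely determined and are the counits of $(A,\Delta)$ and $(\hat A,\hat\Delta)$: $\varepsilon(x)=\langle x,\hat{\mathbf 1}\rangle$, $\hat\varepsilon(\varphi)=\langle\mathbf 1,\varphi\rangle$. Weak bialgebra: a finite dimensional unital algebra $A$ that is also a counital coalgebra $(A,\Delta,\varepsilon)$ such that $\Delta$ is multiplicative, $(\Delta\otimes\mathrm{id})\Delta(\mathbf 1)=(\Delta(\mathbf 1)\otimes\mathbf 1)(\mathbf 1\otimes\Delta(\mathbf 1))=(\mathbf 1\otimes\Delta(\mathbf 1))(\Delta(\mathbf 1)\otimes\mathbf 1)$, and $\varepsilon(xyz)=\varepsilon(xy_{(1)})\varepsilon(y_{(2)}z)=\varepsilon(xy_{(2)})\varepsilon(y_{(1)}z)$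 for all $x,y,z\in A$. *)

(* Defs.v *)
From HB Require Import structures.
From mathcomp Require Import all_boot all_order all_algebra.
From mathcomp Require Import boolp classical_sets reals.
From mathcomp Require Import complex mxtens.

Set Implicit Arguments.
Unset Strict Implicit.
Unset Printing Implicit Defensive.

Import Order.TTheory GRing.Theory Num.Theory.
Local Open Scope classical_set_scope.
Local Open Scope ring_scope.

(* The Hilbert space H is C^n with its standard inner product, so that L(H) is
   'M[C]_n acting on column vectors, L(H (x) H) is 'M[C]_(n * n) and
   L(H (x) H (x) H) is 'M[C]_(n * n * n), with [*t] the Kronecker product and
   [mxtens_index] the numbering of the product basis. *)

Definition adjmx (C : numClosedFieldType) (m n : nat) (X : 'M[C]_(m, n)) :
    'M[C]_(n, m) :=
  map_mx Num.conj X^T.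

Section TensorCalculus.
Variable C : numClosedFieldType.

(* Coefficients of X : L(H (x) K) along one factor, with E_ab matrix units:
     X = \sum_(a, b) rblock X a b (x) E_ab = \sum_(a, b) E_ab (x) lblock X a b. *)
Definition rblock (m n : nat) (X : 'M[C]_(m * n)) (a b : 'I_n) : 'M[C]_m :=
  \matrix_(k, l) X (mxtens_index (k, a)) (mxtens_index (l, b)).

Definition lblock (m n : nat) (X : 'M[C]_(m * n)) (a b : 'I_m) : 'M[C]_n :=
  \matrix_(k, l) X (mxtens_index (a, k)) (mxtens_index (b, l)).

(* (w (x) id)(X) and (id (x) w)(X) for a linear functional w *)
Definition slicel (m n : nat) (w : 'M[C]_m -> C) (X : 'M[C]_(m * n)) : 'M[C]_n :=
  \matrix_(i, j) w (rblock X i j).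

Definition slicer (m n : nat) (w : 'M[C]_n -> C) (X : 'M[C]_(m * n)) : 'M[C]_m :=
  \matrix_(i, j) w (lblock X i j).

(* (w (x) w')(X) *)
Definition slice2 (m n : nat) (w : 'M[C]_m -> C) (w' : 'M[C]_n -> C)
    (X : 'M[C]_(m * n)) : C :=
  w' (slicel w X).

(* (f (x) id)(X) and (id (x) f)(X). If X lies in A (x) A for a subspace A, all
   the blocks of X lie in A, so only the restriction of f to A matters. *)
Definition tensl (m m' n : nat) (f : 'M[C]_m -> 'M[C]_m') (X : 'M[C]_(m * n)) :
    'M[C]_(m' * n) :=
  \matrix_(i, j) f (rblock X (mxtens_unindex i).2 (mxtens_unindex j).2)
                   (mxtens_unindex i).1 (mxtens_unindex j).1.

Definition tensr (m n n' : nat) (f : 'M[C]_n -> 'M[C]_n') (X : 'M[C]_(m * n)) :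
    'M[C]_(m * n') :=
  \matrix_(i, j) f (lblock X (mxtens_unindex i).1 (mxtens_unindex j).1)
                   (mxtens_unindex i).2 (mxtens_unindex j).2.

(* the identification of L(H (x) (H (x) H)) with L((H (x) H) (x) H) *)
Definition reassoc (n : nat) (X : 'M[C]_(n * (n * n))) : 'M[C]_(n * n * n) :=
  castmx (mulnA n n n, mulnA n n n) X.

Definition leg12 (n : nat) (X : 'M[C]_(n * n)) : 'M[C]_(n * n * n) :=
  X *t (1%:M : 'M[C]_n).

Definition leg23 (n : nat) (X : 'M[C]_(n * n)) : 'M[C]_(n * n * n) :=
  reassoc ((1%:M : 'M[C]_n) *t X).

Definition leg13 (n : nat) (X : 'M[C]_(n * n)) : 'M[C]_(n * n * n) :=
  \matrix_(i, j)
    let i12 := mxtens_unindex (mxtens_unindex i).1 in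
    let j12 := mxtens_unindex (mxtens_unindex j).1 in
    X (mxtens_index (i12.1, (mxtens_unindex i).2))
      (mxtens_index (j12.1, (mxtens_unindex j).2)) * (i12.2 == j12.2)%:R.

Lemma rblock_tens m n (a : 'M[C]_m) (b : 'M[C]_n) i j :
  rblock (a *t b) i j = b i j *: a.
Proof. by apply/matrixP => k l; rewrite [LHS]mxE tensmxE mxE mulrC. Qed.

Lemma lblock_tens m n (a : 'M[C]_m) (b : 'M[C]_n) i j :
  lblock (a *t b) i j = a i j *: b.
Proof. by apply/matrixP => k l; rewrite [LHS]mxE tensmxE mxE. Qed.

Lemma slicel_tens m n (w : {scalar 'M[C]_m}) (a : 'M[C]_m) (b : 'M[C]_n) :
  slicel w (a *t b) = w a *: b.
Proof. by apply/matrixP => i j; rewrite !mxE rblock_tens linearZ /= mulrC. Qed.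

Lemma slicer_tens m n (w : {scalar 'M[C]_n}) (a : 'M[C]_m) (b : 'M[C]_n) :
  slicer w (a *t b) = w b *: a.
Proof. by apply/matrixP => i j; rewrite !mxE lblock_tens linearZ /= mulrC. Qed.

Lemma tensl_tens m m' n (f : {linear 'M[C]_m -> 'M[C]_m'})
    (a : 'M[C]_m) (b : 'M[C]_n) :
  tensl f (a *t b) = f a *t b.
Proof. by apply/matrixP => i j; rewrite !mxE rblock_tens linearZ mxE mulrC. Qed.

Lemma tensr_tens m n n' (f : {linear 'M[C]_n -> 'M[C]_n'})
    (a : 'M[C]_m) (b : 'M[C]_n) :
  tensr f (a *t b) = a *t f b.
Proof. by apply/matrixP => i j; rewrite !mxE lblock_tens linearZ mxE. Qed.

Lemma reassoc_tens n (a b c : 'M[C]_n) : reassoc (a *t (b *t c)) = a *t b *t c.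
Proof.
have E (i j k : 'I_n) :
    cast_ord (esym (mulnA n n n)) (mxtens_index (mxtens_index (i, j), k))
    = mxtens_index (i, mxtens_index (j, k)).
  by apply: val_inj; rewrite /= mulnDl addnA mulnA.
apply/matrixP => i j.
case: (mxtens_indexP i) => i12 i3; case: (mxtens_indexP i12) => i1 i2.
case: (mxtens_indexP j) => j12 j3; case: (mxtens_indexP j12) => j1 j2.
by rewrite castmxE /= !E !tensmxE mulrA.
Qed.

Lemma leg12_tens n (a b : 'M[C]_n) : leg12 (a *t b) = a *t b *t 1%:M.
Proof. by []. Qed.

Lemma leg23_tens n (a b : 'M[C]_n) : leg23 (a *t b) = 1%:M *t a *t b.
Proof. exact: reassoc_tens. Qed.

Lemma leg13_tens n (a b : 'M[C]_n) : leg13 (a *t b) = a *t 1%:M *t b.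
Proof.
apply/matrixP => i j.
case: (mxtens_indexP i) => i12 i3; case: (mxtens_indexP i12) => i1 i2.
case: (mxtens_indexP j) => j12 j3; case: (mxtens_indexP j12) => j1 j2.
by rewrite mxE !(mxtens_indexK, tensmxE) mxE mulrAC /= tensmxE.
Qed.

(* A (x) A as a subspace of L(H (x) H) *)
Definition tens_set (n : nat) (A : set 'M[C]_n) : set 'M[C]_(n * n) :=
  [set X | exists2 s : seq ('M[C]_n * 'M[C]_n),
     (forall ab, ab \in s -> A ab.1 /\ A ab.2)
     & X = \sum_(ab <- s) ab.1 *t ab.2].

End TensorCalculus.

Section WeakBialgebra.
Variables (C : numClosedFieldType) (n : nat).

Record is_subalgebra (A : set 'M[C]_n) : Prop := IsSubalgebra {
  subalg0 : A 0 ;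
  subalgP : forall (c : C) x y, A x -> A y -> A (c *: x + y) ;
  subalgM : forall x y, A x -> A y -> A (x *m y) }.

(* The unit need not be the identity operator; it is 0 if A = 0. *)
Definition is_unit_of (A : set 'M[C]_n) (u : 'M[C]_n) : Prop :=
  A u /\ (forall x, A x -> u *m x = x /\ x *m u = x).

(* (D, e) is a counital coalgebra structure on the subspace A; every linear
   functional on A extends to L(H), and only the restriction of e matters. *)
Record is_coalgebra (A : set 'M[C]_n) (D : 'M[C]_n -> 'M[C]_(n * n))
    (e : {scalar 'M[C]_n}) : Prop := IsCoalgebra {
  coalg_lin : forall (c : C) x y, A x -> A y -> D (c *: x + y) = c *: D x + D y ;
  coalg_sub : forall x, A x -> tens_set A (D x) ;
  coalg_assoc : forall x, A x -> tensl D (D x) = reassoc (tensr D (D x)) ;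
  coalg_counitl : forall x, A x -> slicel e (D x) = x ;
  coalg_counitr : forall x, A x -> slicer e (D x) = x }.

(* In [wb_counit1] and [wb_counit2] the argument of [slice2 e e] is
   x y_(1) (x) y_(2) z and y_(1) z (x) x y_(2), respectively. *)
Record is_weak_bialgebra_with (A : set 'M[C]_n) (D : 'M[C]_n -> 'M[C]_(n * n))
    (u : 'M[C]_n) (e : {scalar 'M[C]_n}) : Prop := IsWeakBialgebraWith {
  wb_alg : is_subalgebra A ;
  wb_one : is_unit_of A u ;
  wb_coalg : is_coalgebra A D e ;
  wb_mul : forall x y, A x -> A y -> D (x *m y) = D x *m D y ;
  wb_unit1 : tensl D (D u) = (D u *t u) *m reassoc (u *t D u) ;
  wb_unit2 : tensl D (D u) = reassoc (u *t D u) *m (D u *t u) ;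
  wb_counit1 : forall x y z, A x -> A y -> A z ->
    e (x *m y *m z)
    = slice2 e e ((x *t (1%:M : 'M[C]_n)) *m D y *m ((1%:M : 'M[C]_n) *t z)) ;
  wb_counit2 : forall x y z, A x -> A y -> A z ->
    e (x *m y *m z)
    = slice2 e e (((1%:M : 'M[C]_n) *t x) *m D y *m (z *t (1%:M : 'M[C]_n))) }.

Definition is_weak_bialgebra (A : set 'M[C]_n) (D : 'M[C]_n -> 'M[C]_(n * n)) :
    Prop :=
  exists u e, is_weak_bialgebra_with A D u e.

(* <X, phi (x) psi> = c, the pairing of A (x) A with B (x) B being the one
   induced by the pairing p of A and B. *)
Definition tens_pairing_l (p : 'M[C]_n -> 'M[C]_n -> C) (A : set 'M[C]_n)
    (X : 'M[C]_(n * n)) (phi psi : 'M[C]_n) (c : C) : Prop :=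
  forall s : seq ('M[C]_n * 'M[C]_n),
    (forall ab, ab \in s -> A ab.1 /\ A ab.2) ->
    X = \sum_(ab <- s) ab.1 *t ab.2 ->
    \sum_(ab <- s) p ab.1 phi * p ab.2 psi = c.

(* A pairing on A x B, for which A and B, with the given coproducts, units and
   counits, are dual to each other; p is only relevant on A x B. *)
Record in_duality (p : 'M[C]_n -> 'M[C]_n -> C)
    (A : set 'M[C]_n) (DA : 'M[C]_n -> 'M[C]_(n * n))
    (uA : 'M[C]_n) (eA : 'M[C]_n -> C)
    (B : set 'M[C]_n) (DB : 'M[C]_n -> 'M[C]_(n * n))
    (uB : 'M[C]_n) (eB : 'M[C]_n -> C) : Prop := InDuality {
  dual_linl : forall (c : C) x y phi, A x -> A y -> B phi ->
    p (c *: x + y) phi = c * p x phi + p y phi ;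
  dual_linr : forall (c : C) x phi psi, A x -> B phi -> B psi ->
    p x (c *: phi + psi) = c * p x phi + p x psi ;
  dual_nondegl : forall x, A x -> (forall phi, B phi -> p x phi = 0) -> x = 0 ;
  dual_nondegr : forall phi, B phi -> (forall x, A x -> p x phi = 0) -> phi = 0 ;
  dual_coprodA : forall x phi psi, A x -> B phi -> B psi ->
    tens_pairing_l p A (DA x) phi psi (p x (phi *m psi)) ;
  dual_coprodB : forall x y phi, A x -> A y -> B phi ->
    tens_pairing_l (fun b a => p a b) B (DB phi) x y (p (x *m y) phi) ;
  dual_counitA : forall x, A x -> eA x = p x uB ;
  dual_counitB : forall phi, B phi -> eB phi = p uA phi }.

End WeakBialgebra.

Section MultiplicativePartialIsometry.
Variables (C : numClosedFieldType) (n : nat).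

Record is_MPI (V : 'M[C]_(n * n)) : Prop := IsMPI {
  mpi_partial_isometry : V *m adjmx V *m V = V ;
  mpi_pentagon :
    leg23 V *m leg12 V = leg12 V *m leg13 V *m leg23 V ;
  mpi_range :
    leg13 V *m leg23 V *m adjmx (leg23 V) = adjmx (leg12 V) *m leg12 V *m leg13 V ;
  mpi_comm1 :
    leg12 V *m adjmx (leg12 V) *m leg23 V = leg23 V *m leg12 V *m adjmx (leg12 V) ;
  mpi_comm2 :
    leg12 V *m adjmx (leg23 V) *m leg23 V = adjmx (leg23 V) *m leg23 V *m leg12 V }.

Variable V : 'M[C]_(n * n).

Definition mpi_lambda (w : {scalar 'M[C]_n}) : 'M[C]_n := slicel w V.
Definition mpi_rho (w : {scalar 'M[C]_n}) : 'M[C]_n := slicer w V.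

Definition right_leg : set 'M[C]_n := [set mpi_lambda w | w in setT].
Definition left_leg : set 'M[C]_n := [set mpi_rho w | w in setT].

Definition right_coprod (X : 'M[C]_n) : 'M[C]_(n * n) :=
  V *m (X *t (1%:M : 'M[C]_n)) *m adjmx V.

Definition left_coprod (X : 'M[C]_n) : 'M[C]_(n * n) :=
  adjmx V *m ((1%:M : 'M[C]_n) *t X) *m V.

Definition is_canonical_pairing (p : 'M[C]_n -> 'M[C]_n -> C) : Prop :=
  forall w w' : {scalar 'M[C]_n}, p (mpi_lambda w) (mpi_rho w') = slice2 w w' V.

Definition is_unital : Prop :=
  exists e eh : {scalar 'M[C]_n},
    is_unit_of right_leg (mpi_lambda eh) /\ is_unit_of left_leg (mpi_rho e).

End MultiplicativePartialIsometry.

(* Main.v *)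
Require Import Defs.
From HB Require Import structures.
From mathcomp Require Import all_boot all_order all_algebra.
From mathcomp Require Import boolp classical_sets reals.
From mathcomp Require Import complex mxtens.

(** Write E = V^* V and F = V V^*, and evaluate functionals on single legs of
    identities between operators on three legs.

    The pentagon equation together with V13 F23 = E12 V13 gives
      V23 V12 V23^* = V12 V13   and   V12^* V23 V12 = V13 V23
    ([right_coprod_V], [left_coprod_V]).  Slicing these identities shows that
    each coproduct is the transpose of the multiplication of the other leg for
    the pairing <lambda w, rho w'> = (w (x) w')(V) ([right_dual], [left_dual]).
    Hence the legs are algebras, the coproducts map each leg S to S (x) S, and
    a functional e is a counit of the right leg exactly when rho e is the unit
    of the left leg, and conversely with the roles of the legs exchanged.  In
    particular, if both legs are weak bialgebras then V is unital, and their
    units and counits are the ones forced by the canonical pairing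
    ([right_counit_unit], [left_counit_unit], [canonical_duality]).

    Now let u = lambda eh and uh = rho e be units.  Evaluating e on the third
    leg of V13 F23 = E12 V13 gives E, and evaluating eh on its first leg gives
    F.  So E and F are slices of operators that visibly absorb u or uh on the
    remaining legs.  As E and F are self-adjoint, they absorb the adjoints of u
    and uh from the other side, and V = F V = V E inherits this.  It follows
    that u and uh are self-adjoint and, finally, that u = uh ([u_uh]).
    Therefore V absorbs this projection on both legs and from both sides, and
      Delta(u) = F,   hat Delta(uh) = E
    ([right_coprod_unit], [left_coprod_unit]).

    The unit axioms are then the commutation relations of the definition of an
    MPI: (id (x) Delta)(F) = V23 F12 V23^* = F12 F23 = F23 F12, and likewise
    for E.  The counit axioms of one leg are the unit axioms of the other, read
    through the pairing: e (lambda f * lambda g) = (f (x) g)(E), and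
    e (lambda f * lambda g * lambda h) = (f (x) g (x) h)(E12 E23). *)

Set Implicit Arguments.
Unset Strict Implicit.
Unset Printing Implicit Defensive.
Import GRing.Theory Num.Theory.
Local Open Scope ring_scope.

(** * Linear maps on tensor products *)

Section Linearity.
Variable C : numClosedFieldType.

Fact slicel_linear m n (w : {scalar 'M[C]_m}) : linear (@slicel C m n w).
Proof.
move=> c X Y; apply/matrixP => i j; rewrite !mxE -linearP; congr (w _).
by apply/matrixP => k l; rewrite !mxE.
Qed.
HB.instance Definition _ m n (w : {scalar 'M[C]_m}) :=
  GRing.isLinear.Build C 'M[C]_(m * n) 'M[C]_n *:%R (@slicel C m n w)
    (@slicel_linear m n w).

Fact slicer_linear m n (w : {scalar 'M[C]_n}) : linear (@slicer C m n w).
Proof.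
move=> c X Y; apply/matrixP => i j; rewrite !mxE -linearP; congr (w _).
by apply/matrixP => k l; rewrite !mxE.
Qed.
HB.instance Definition _ m n (w : {scalar 'M[C]_n}) :=
  GRing.isLinear.Build C 'M[C]_(m * n) 'M[C]_m *:%R (@slicer C m n w)
    (@slicer_linear m n w).

Fact tensl_linear m m' n (f : {linear 'M[C]_m -> 'M[C]_m'}) :
  linear (@tensl C m m' n f).
Proof.
move=> c X Y; apply/matrixP => i j; rewrite !mxE.
set A := rblock X _ _; set B := rblock Y _ _.
suff -> : rblock (c *: X + Y) (mxtens_unindex i).2 (mxtens_unindex j).2
  = c *: A + B by rewrite linearP !mxE.
by apply/matrixP => k l; rewrite !mxE.
Qed.
HB.instance Definition _ m m' n (f : {linear 'M[C]_m -> 'M[C]_m'}) :=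
  GRing.isLinear.Build C 'M[C]_(m * n) 'M[C]_(m' * n) *:%R (@tensl C m m' n f)
    (@tensl_linear m m' n f).

Fact tensr_linear m n n' (f : {linear 'M[C]_n -> 'M[C]_n'}) :
  linear (@tensr C m n n' f).
Proof.
move=> c X Y; apply/matrixP => i j; rewrite !mxE.
set A := lblock X _ _; set B := lblock Y _ _.
suff -> : lblock (c *: X + Y) (mxtens_unindex i).1 (mxtens_unindex j).1
  = c *: A + B by rewrite linearP !mxE.
by apply/matrixP => k l; rewrite !mxE.
Qed.
HB.instance Definition _ m n n' (f : {linear 'M[C]_n -> 'M[C]_n'}) :=
  GRing.isLinear.Build C 'M[C]_(m * n) 'M[C]_(m * n') *:%R (@tensr C m n n' f)
    (@tensr_linear m n n' f).

Fact tensmxl_linear m n (Y : 'M[C]_n) :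
  linear (fun X : 'M[C]_m => X *t Y).
Proof. by move=> c X X'; apply/matrixP => i j; rewrite !mxE mulrDl mulrA. Qed.

Fact tensmxr_linear m n (X : 'M[C]_m) : linear (@tensmx C m m n n X).
Proof.
by move=> c Y Y'; apply/matrixP => i j; rewrite !mxE mulrDr mulrCA.
Qed.
HB.instance Definition _ m n (X : 'M[C]_m) :=
  GRing.isLinear.Build C 'M[C]_n 'M[C]_(m * n) *:%R (@tensmx C m m n n X)
    (@tensmxr_linear m n X).

Fact reassoc_linear n : linear (@reassoc C n).
Proof.
by move=> c X Y; apply/matrixP => i j;
  rewrite /reassoc !(castmxE, mxE).
Qed.
HB.instance Definition _ n :=
  GRing.isLinear.Build C 'M[C]_(n * (n * n)) 'M[C]_(n * n * n) *:%R
    (@reassoc C n) (@reassoc_linear n).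

Fact leg12_linear n : linear (@leg12 C n).
Proof. exact: tensmxl_linear. Qed.
HB.instance Definition _ n :=
  GRing.isLinear.Build C 'M[C]_(n * n) 'M[C]_(n * n * n) *:%R
    (@leg12 C n) (@leg12_linear n).

Fact leg23_linear n : linear (@leg23 C n).
Proof. by move=> c X Y; rewrite /leg23 !linearP. Qed.
HB.instance Definition _ n :=
  GRing.isLinear.Build C 'M[C]_(n * n) 'M[C]_(n * n * n) *:%R
    (@leg23 C n) (@leg23_linear n).

Fact leg13_linear n : linear (@leg13 C n).
Proof.
by move=> c X Y; apply/matrixP => i j; rewrite !mxE /= !mxE mulrDl mulrA.
Qed.
HB.instance Definition _ n :=
  GRing.isLinear.Build C 'M[C]_(n * n) 'M[C]_(n * n * n) *:%R
    (@leg13 C n) (@leg13_linear n).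

Fact right_coprod_linear n (V : 'M[C]_(n * n)) : linear (right_coprod V).
Proof.
by move=> c X Y; rewrite /right_coprod tensmxl_linear linearP mulmxDl scalemxAl.
Qed.
HB.instance Definition _ n (V : 'M[C]_(n * n)) :=
  GRing.isLinear.Build C 'M[C]_n 'M[C]_(n * n) *:%R (right_coprod V)
    (@right_coprod_linear n V).

Fact left_coprod_linear n (V : 'M[C]_(n * n)) : linear (left_coprod V).
Proof.
by move=> c X Y; rewrite /left_coprod !linearP mulmxDl scalemxAl.
Qed.
HB.instance Definition _ n (V : 'M[C]_(n * n)) :=
  GRing.isLinear.Build C 'M[C]_n 'M[C]_(n * n) *:%R (left_coprod V)
    (@left_coprod_linear n V).

Definition entry m n (i : 'I_m) (j : 'I_n) (X : 'M[C]_(m, n)) := X i j.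
Fact entry_linear m n (i : 'I_m) (j : 'I_n) : scalar (entry i j).
Proof. by move=> c X Y; rewrite /entry !mxE. Qed.
HB.instance Definition _ m n (i : 'I_m) (j : 'I_n) :=
  GRing.isLinear.Build C 'M[C]_(m, n) C *%R (entry i j) (entry_linear i j).

Lemma scalar_eq n (x y : 'M[C]_n) :
  (forall w : {scalar 'M[C]_n}, w x = w y) -> x = y.
Proof. by move=> H; apply/matrixP => i j; exact: (H (entry i j)). Qed.

Definition comb_scalar n (c : C) (w w' : 'M[C]_n -> C) X := c * w X + w' X.
Fact comb_scalar_linear n c (w w' : {scalar 'M[C]_n}) :
  scalar (comb_scalar c w w').
Proof.
move=> d X Y; rewrite /comb_scalar !linearP /= !mulrDr addrACA; congr (_ + _ + _).
exact: mulrCA.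
Qed.
HB.instance Definition _ n c (w w' : {scalar 'M[C]_n}) :=
  GRing.isLinear.Build C 'M[C]_n C *%R (comb_scalar c w w')
    (@comb_scalar_linear n c w w').

Lemma rblock_sum m n (X : 'M[C]_(m * n)) :
  X = \sum_(ab : 'I_n * 'I_n) rblock X ab.1 ab.2 *t delta_mx ab.1 ab.2.
Proof.
apply/matrixP => i j; case: (mxtens_indexP i) => i1 i2.
case: (mxtens_indexP j) => j1 j2; rewrite summxE (bigD1 (i2, j2)) //= big1.
  by rewrite tensmxE !mxE !eqxx mulr1 addr0.
move=> [a b] ne; rewrite tensmxE !mxE /=.
case: eqP => [ea|]; case: eqP => [eb|]; rewrite ?mulr0 //=.
by rewrite ea eb eqxx in ne.
Qed.

Lemma lblock_sum m n (X : 'M[C]_(m * n)) :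
  X = \sum_(ab : 'I_m * 'I_m) delta_mx ab.1 ab.2 *t lblock X ab.1 ab.2.
Proof.
apply/matrixP => i j; case: (mxtens_indexP i) => i1 i2.
case: (mxtens_indexP j) => j1 j2; rewrite summxE (bigD1 (i1, j1)) //= big1.
  by rewrite tensmxE !mxE !eqxx mul1r addr0.
move=> [a b] ne; rewrite tensmxE !mxE /=.
case: eqP => [ea|]; case: eqP => [eb|]; rewrite ?mul0r //=.
by rewrite ea eb eqxx in ne.
Qed.

(** Makes an identity that is linear in X a computation with pure tensors. *)
Lemma tens_ind m n (P : 'M[C]_(m * n) -> Prop) :
  (forall c X Y, P X -> P Y -> P (c *: X + Y)) ->
  (forall a b, P (a *t b)) -> forall X, P X.
Proof.
move=> Plin Ptens X; rewrite [X]rblock_sum; apply: big_ind => //.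
  by rewrite -(tensmx0 (0 : 'M[C]_m)).
by move=> Y Z PY PZ; rewrite -[Y]scale1r; apply: Plin.
Qed.

Lemma tens_ind3 n (P : 'M[C]_(n * n * n) -> Prop) :
  (forall c X Y, P X -> P Y -> P (c *: X + Y)) ->
  (forall a b c, P (a *t b *t c)) -> forall X, P X.
Proof.
move=> Plin Ptens; apply: tens_ind => // + c; apply: tens_ind => // d X Y PX PY.
by rewrite tensmxl_linear; apply: Plin.
Qed.

Fact mulmx_linearl m n p (c : C) (X Y : 'M_(m, n)) (Z : 'M_(n, p)) :
  (c *: X + Y) *m Z = c *: (X *m Z) + Y *m Z.
Proof. by rewrite mulmxDl scalemxAl. Qed.

(** * Legs, adjoints and slices *)

Lemma reassocM n (X Y : 'M[C]_(n * (n * n))) :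
  reassoc (X *m Y) = reassoc X *m reassoc Y.
Proof. by rewrite /reassoc; case: _ / (mulnA n n n). Qed.

Lemma leg12M n (X Y : 'M[C]_(n * n)) : leg12 (X *m Y) = leg12 X *m leg12 Y.
Proof. by rewrite /leg12 tensmx_mul mulmx1. Qed.

Lemma leg23M n (X Y : 'M[C]_(n * n)) : leg23 (X *m Y) = leg23 X *m leg23 Y.
Proof. by rewrite /leg23 -reassocM tensmx_mul mulmx1. Qed.

Lemma leg13M n (X Y : 'M[C]_(n * n)) : leg13 (X *m Y) = leg13 X *m leg13 Y.
Proof.
elim/tens_ind: X => [c X X' HX HX'|a b].
  by rewrite !(linearP, mulmx_linearl) /= HX HX'.
elim/tens_ind: Y => [c Y Y' HY HY'|a' b']; first by rewrite !linearP /= HY HY'.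
by rewrite !(tensmx_mul, leg13_tens) mulmx1.
Qed.

Lemma adjmx_semilinear m n c (X Y : 'M[C]_(m, n)) :
  adjmx (c *: X + Y) = Num.conj c *: adjmx X + adjmx Y.
Proof. by apply/matrixP => i j; rewrite !mxE rmorphD rmorphM. Qed.

Lemma adjmxM m n p (X : 'M[C]_(m, n)) (Y : 'M[C]_(n, p)) :
  adjmx (X *m Y) = adjmx Y *m adjmx X.
Proof. by rewrite /adjmx trmx_mul map_mxM. Qed.

Lemma adjmxK m n (X : 'M[C]_(m, n)) : adjmx (adjmx X) = X.
Proof. by apply/matrixP => i j; rewrite !mxE conjCK. Qed.

Lemma adjmx1 n : adjmx (1%:M : 'M[C]_n) = 1%:M.
Proof. by rewrite /adjmx trmx1 map_mx1. Qed.

Lemma adjmx_tens m n (X : 'M[C]_m) (Y : 'M[C]_n) :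
  adjmx (X *t Y) = adjmx X *t adjmx Y.
Proof. by rewrite /adjmx trmx_tens map_mxT. Qed.

Lemma leg12_adj n (X : 'M[C]_(n * n)) : leg12 (adjmx X) = adjmx (leg12 X).
Proof. by rewrite /leg12 adjmx_tens adjmx1. Qed.

Lemma leg23_adj n (X : 'M[C]_(n * n)) : leg23 (adjmx X) = adjmx (leg23 X).
Proof.
elim/tens_ind: X => [c X X' HX HX'|a b].
  by rewrite !(linearP, adjmx_semilinear) /= HX HX'.
by rewrite !(leg23_tens, adjmx_tens) adjmx1.
Qed.

Lemma leg13_adj n (X : 'M[C]_(n * n)) : leg13 (adjmx X) = adjmx (leg13 X).
Proof.
elim/tens_ind: X => [c X X' HX HX'|a b].
  by rewrite !(linearP, adjmx_semilinear) /= HX HX'.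
by rewrite !(leg13_tens, adjmx_tens) adjmx1.
Qed.

Lemma slicerMl m n (w : {scalar 'M[C]_n}) (X : 'M[C]_m) (Z : 'M[C]_(m * n)) :
  slicer w ((X *t 1%:M) *m Z) = X *m slicer w Z.
Proof.
elim/tens_ind: Z => [c Y Z HY HZ|a b].
  by rewrite !linearP /= HY HZ.
by rewrite tensmx_mul mul1mx !slicer_tens -scalemxAr.
Qed.

Lemma slicerMr m n (w : {scalar 'M[C]_n}) (X : 'M[C]_m) (Z : 'M[C]_(m * n)) :
  slicer w (Z *m (X *t 1%:M)) = slicer w Z *m X.
Proof.
elim/tens_ind: Z => [c Y Z HY HZ|a b].
  by rewrite mulmx_linearl !linearP /= mulmx_linearl HY HZ.
by rewrite tensmx_mul mulmx1 !slicer_tens -scalemxAl.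
Qed.

Lemma slicelMl m n (w : {scalar 'M[C]_m}) (X : 'M[C]_n) (Z : 'M[C]_(m * n)) :
  slicel w ((1%:M *t X) *m Z) = X *m slicel w Z.
Proof.
elim/tens_ind: Z => [c Y Z HY HZ|a b].
  by rewrite !linearP /= HY HZ.
by rewrite tensmx_mul mul1mx !slicel_tens -scalemxAr.
Qed.

Lemma slicelMr m n (w : {scalar 'M[C]_m}) (X : 'M[C]_n) (Z : 'M[C]_(m * n)) :
  slicel w (Z *m (1%:M *t X)) = slicel w Z *m X.
Proof.
elim/tens_ind: Z => [c Y Z HY HZ|a b].
  by rewrite mulmx_linearl !linearP /= mulmx_linearl HY HZ.
by rewrite tensmx_mul mulmx1 !slicel_tens -scalemxAl.
Qed.

Lemma slice2E m n (w : {scalar 'M[C]_m}) (w' : {scalar 'M[C]_n}) Z :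
  slice2 w w' Z = w (slicer w' Z).
Proof.
rewrite /slice2; elim/tens_ind: Z => [c Y Z HY HZ|a b].
  by rewrite !linearP /= HY HZ.
by rewrite slicel_tens slicer_tens !linearZ /= mulrC.
Qed.

Lemma slicel_inj m n (X Y : 'M[C]_(m * n)) :
  (forall w : {scalar 'M[C]_m}, slicel w X = slicel w Y) -> X = Y.
Proof.
move=> H; apply/matrixP => i j; case: (mxtens_indexP i) => a k.
case: (mxtens_indexP j) => b l.
by have /matrixP/(_ k l) := H (entry a b); rewrite !mxE /= /entry !mxE.
Qed.

Lemma slicer_inj m n (X Y : 'M[C]_(m * n)) :
  (forall w : {scalar 'M[C]_n}, slicer w X = slicer w Y) -> X = Y.
Proof.
move=> H; apply/matrixP => i j; case: (mxtens_indexP i) => a k.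
case: (mxtens_indexP j) => b l.
by have /matrixP/(_ a b) := H (entry k l); rewrite !mxE /= /entry !mxE.
Qed.

(** (w (x) id (x) id)(Z); the counterpart id (x) id (x) w needs no definition of
    its own, since it is [slicer w] for the splitting of n * n * n as
    (n * n) * n. *)
Definition slice1 n (w : 'M[C]_n -> C) (Z : 'M[C]_(n * n * n)) : 'M[C]_(n * n) :=
  slicel w (castmx (esym (mulnA n n n), esym (mulnA n n n)) Z).

Lemma slice1_reassoc n (w : 'M[C]_n -> C) (Z : 'M[C]_(n * (n * n))) :
  slice1 w (reassoc Z) = slicel w Z.
Proof. by rewrite /slice1 /reassoc castmxK. Qed.

Fact slice1_linear n (w : {scalar 'M[C]_n}) : linear (slice1 w).
Proof.
move=> c X Y; rewrite /slice1 -linearP; congr (slicel w _).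
by apply/matrixP => i j; rewrite !(castmxE, mxE).
Qed.
HB.instance Definition _ n (w : {scalar 'M[C]_n}) :=
  GRing.isLinear.Build C 'M[C]_(n * n * n) 'M[C]_(n * n) *:%R (slice1 w)
    (@slice1_linear n w).

Lemma slice1_tens n (w : {scalar 'M[C]_n}) a b c :
  slice1 w (a *t b *t c) = w a *: (b *t c).
Proof. by rewrite -reassoc_tens slice1_reassoc slicel_tens. Qed.

Variable n : nat.
Implicit Types (X Y : 'M[C]_(n * n)) (Z : 'M[C]_(n * n * n)) (w : {scalar 'M[C]_n}).

Lemma reassocK Z : exists Z' : 'M[C]_(n * (n * n)), Z = reassoc Z'.
Proof.
by exists (castmx (esym (mulnA n n n), esym (mulnA n n n)) Z); rewrite /reassoc castmxKV.
Qed.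

Lemma slice1Ml w X Z : slice1 w (leg23 X *m Z) = X *m slice1 w Z.
Proof.
by case: (reassocK Z) => {}Z ->;
  rewrite -reassocM !slice1_reassoc slicelMl.
Qed.

Lemma slice1Mr w X Z : slice1 w (Z *m leg23 X) = slice1 w Z *m X.
Proof.
by case: (reassocK Z) => {}Z ->;
  rewrite -reassocM !slice1_reassoc slicelMr.
Qed.

Lemma slice1_leg12 w X : slice1 w (leg12 X) = slicel w X *t 1%:M.
Proof.
elim/tens_ind: X => [c X X' HX HX'|a b].
  by rewrite !linearP /= HX HX' tensmxl_linear.
by rewrite slice1_tens slicel_tens -[w a *: b]addr0 tensmxl_linear tens0mx addr0.
Qed.

Lemma slice1_leg13 w X : slice1 w (leg13 X) = 1%:M *t slicel w X.
Proof.
elim/tens_ind: X => [c X X' HX HX'|a b].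
  by rewrite !linearP /= HX HX'.
by rewrite leg13_tens slice1_tens slicel_tens linearZ.
Qed.

Lemma slicer_leg13 w X : slicer w (leg13 X) = slicer w X *t 1%:M.
Proof.
elim/tens_ind: X => [c X X' HX HX'|a b].
  by rewrite !linearP /= HX HX' tensmxl_linear.
rewrite leg13_tens !slicer_tens.
by rewrite -[w b *: a]addr0 tensmxl_linear tens0mx addr0.
Qed.

Lemma slicer_leg23 w X : slicer w (leg23 X) = 1%:M *t slicer w X.
Proof.
elim/tens_ind: X => [c X X' HX HX'|a b].
  by rewrite !linearP /= HX HX'.
by rewrite leg23_tens !slicer_tens linearZ.
Qed.

(** Both sides are (f (x) g (x) h)(Z). *)
Lemma slice3E (f g h : {scalar 'M[C]_n}) Z :
  f (slicer g (slicer h Z)) = h (slicel g (slice1 f Z)).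
Proof.
elim/tens_ind3: Z => [c Y Z HY HZ|a b c]; first by rewrite !linearP /= HY HZ.
rewrite slice1_tens !(slicer_tens, linearZ) /= !(slicer_tens, slicel_tens, linearZ) /=.
by rewrite mulrC -mulrA mulrCA.
Qed.

End Linearity.
(** * The coproducts as conjugations on three legs *)

Section Coproducts.
Variables (C : numClosedFieldType) (n : nat).
Implicit Types (P Q X : 'M[C]_(n * n)) (w f g : {scalar 'M[C]_n}).

Lemma tensl_right_coprod V X :
  tensl (@right_coprod C n V) X = leg12 V *m leg13 X *m leg12 (adjmx V).
Proof.
elim/tens_ind: X => [c X X' HX HX'|a b].
  by rewrite !(linearP, mulmx_linearl) /= HX HX'.
by rewrite tensl_tens /= leg13_tens /right_coprod /leg12 !tensmx_mul mul1mx mulmx1.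
Qed.

Lemma tensr_right_coprod V X :
  reassoc (tensr (@right_coprod C n V) X)
  = leg23 V *m leg12 X *m leg23 (adjmx V).
Proof.
elim/tens_ind: X => [c X X' HX HX'|a b].
  by rewrite !(linearP, mulmx_linearl) /= HX HX'.
rewrite tensr_tens /= leg12_tens -reassoc_tens -!reassocM /right_coprod.
by rewrite !tensmx_mul mul1mx mulmx1.
Qed.

Lemma tensl_left_coprod V X :
  tensl (@left_coprod C n V) X = leg12 (adjmx V) *m leg23 X *m leg12 V.
Proof.
elim/tens_ind: X => [c X X' HX HX'|a b].
  by rewrite !(linearP, mulmx_linearl) /= HX HX'.
by rewrite tensl_tens /= leg23_tens /left_coprod /leg12 !tensmx_mul mul1mx mulmx1.
Qed.

Lemma tensr_left_coprod V X :
  reassoc (tensr (@left_coprod C n V) X)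
  = leg23 (adjmx V) *m leg13 X *m leg23 V.
Proof.
elim/tens_ind: X => [c X X' HX HX'|a b].
  by rewrite !(linearP, mulmx_linearl) /= HX HX'.
rewrite tensr_tens /= leg13_tens -reassoc_tens -!reassocM /left_coprod.
by rewrite !tensmx_mul mul1mx mulmx1.
Qed.

Lemma slice1_right_coprod V w X :
  slice1 w (leg23 V *m leg12 X *m leg23 (adjmx V)) = right_coprod V (slicel w X).
Proof. by rewrite slice1Mr slice1Ml slice1_leg12. Qed.

Lemma slicer_left_coprod V w X :
  slicer w (leg12 (adjmx V) *m leg23 X *m leg12 V) = left_coprod V (slicer w X).
Proof. by rewrite slicerMr slicerMl slicer_leg23. Qed.

Lemma leg23_comm1 x X :
  leg23 X *m leg12 (x *t 1%:M) = leg12 (x *t 1%:M) *m leg23 X.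
Proof.
elim/tens_ind: X => [c X X' HX HX'|a b].
  by rewrite !(linearP, mulmx_linearl) /= HX HX'.
by rewrite leg23_tens leg12_tens !tensmx_mul !(mul1mx, mulmx1).
Qed.

Lemma leg12_comm3 x X :
  leg12 X *m leg23 (1%:M *t x) = leg23 (1%:M *t x) *m leg12 X.
Proof.
elim/tens_ind: X => [c X X' HX HX'|a b].
  by rewrite !(linearP, mulmx_linearl) /= HX HX'.
by rewrite leg23_tens leg12_tens !tensmx_mul !(mul1mx, mulmx1).
Qed.

Lemma leg13_comm2 x X :
  leg13 X *m leg12 (1%:M *t x) = leg12 (1%:M *t x) *m leg13 X.
Proof.
elim/tens_ind: X => [c X X' HX HX'|a b].
  by rewrite !(linearP, mulmx_linearl) /= HX HX'.
by rewrite leg13_tens leg12_tens !tensmx_mul !(mul1mx, mulmx1).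
Qed.

Lemma slice2_linear m k (w : {scalar 'M[C]_m}) (w' : {scalar 'M[C]_k}) :
  scalar (slice2 w w').
Proof. by move=> c X Y; rewrite /slice2 !linearP. Qed.
HB.instance Definition _ m k (w : {scalar 'M[C]_m}) (w' : {scalar 'M[C]_k}) :=
  GRing.isLinear.Build C 'M[C]_(m * k) C *%R (slice2 w w')
    (@slice2_linear m k w w').

Lemma tens_leg12 X (x : 'M[C]_n) : X *t x = leg12 X *m leg23 (1%:M *t x).
Proof.
elim/tens_ind: X => [c X X' HX HX'|a b].
  by rewrite tensmxl_linear HX HX' linearP mulmx_linearl.
by rewrite leg23_tens leg12_tens !tensmx_mul !(mul1mx, mulmx1).
Qed.

Lemma tens_leg23 X (x : 'M[C]_n) :
  reassoc (x *t X) = leg12 (x *t 1%:M) *m leg23 X.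
Proof.
elim/tens_ind: X => [c X X' HX HX'|a b].
  by rewrite !(linearP, mulmx_linearl) /= HX HX'.
by rewrite leg23_tens leg12_tens reassoc_tens !tensmx_mul !(mul1mx, mulmx1).
Qed.

(** Reduces the products in the unit axioms, where x is only a unit of the leg
    and not the identity operator, to honest leg embeddings. *)
Lemma unit_legs X (x : 'M[C]_n) :
    X *m (x *t 1%:M) = X -> (1%:M *t x) *m X = X ->
  (X *t x) *m reassoc (x *t X) = leg12 X *m leg23 X.
Proof.
move=> Xx xX; rewrite tens_leg12 tens_leg23 mulmxA -(mulmxA (leg12 X)).
by rewrite leg23_comm1 mulmxA -leg12M Xx -mulmxA -leg23M xX.
Qed.

Lemma unit_legs_rev X (x : 'M[C]_n) :
    (x *t 1%:M) *m X = X -> X *m (1%:M *t x) = X ->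
    leg12 X *m leg23 X = leg23 X *m leg12 X ->
  reassoc (x *t X) *m (X *t x) = leg12 X *m leg23 X.
Proof.
move=> xX Xx XX; rewrite tens_leg12 tens_leg23 mulmxA -(mulmxA (leg12 _)) -XX.
by rewrite mulmxA -leg12M xX -mulmxA -leg23M Xx.
Qed.

Lemma slice2_mul_lr (f g : {scalar 'M[C]_n}) (x z : 'M[C]_n) X :
  slice2 f g ((x *t 1%:M) *m X *m (1%:M *t z))
  = slice2 (f \o mulmx x) (g \o mulmxr z) X.
Proof.
elim/tens_ind: X => [c X X' HX HX'|a b].
  by rewrite !(linearP, mulmx_linearl) /= HX HX'.
by rewrite !tensmx_mul mul1mx mulmx1 /slice2 !slicel_tens !linearZ.
Qed.

Lemma slice2_mul_rl (f g : {scalar 'M[C]_n}) (x z : 'M[C]_n) X :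
  slice2 f g ((1%:M *t x) *m X *m (z *t 1%:M))
  = slice2 (f \o mulmxr z) (g \o mulmx x) X.
Proof.
elim/tens_ind: X => [c X X' HX HX'|a b].
  by rewrite !(linearP, mulmx_linearl) /= HX HX'.
by rewrite !tensmx_mul mul1mx mulmx1 /slice2 !slicel_tens !linearZ.
Qed.

Lemma slicer_legM f g X Y :
  slicer f (slicer g (leg12 X *m leg13 Y)) = slicer f X *m slicer g Y.
Proof. by rewrite slicerMl slicer_leg13 slicerMr. Qed.

Lemma slicel_legM f g X Y :
  slicel g (slice1 f (leg13 X *m leg23 Y)) = slicel f X *m slicel g Y.
Proof. by rewrite slice1Mr slice1_leg13 slicelMl. Qed.

End Coproducts.

(** * Multiplicative partial isometries *)

Section MPI.
Variables (C : numClosedFieldType) (n : nat) (V : 'M[C]_(n * n)).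
Hypothesis hV : is_MPI V.

Notation W := (adjmx V).
Notation E := (W *m V).
Notation F := (V *m W).
Notation A := (right_leg V).
Notation Ah := (left_leg V).
Notation D := (right_coprod V).
Notation Dh := (left_coprod V).
Implicit Types (w f g h : {scalar 'M[C]_n}).

Lemma VE : V *m E = V. Proof. by rewrite mulmxA (mpi_partial_isometry hV). Qed.
Lemma FV : F *m V = V. Proof. exact: mpi_partial_isometry hV. Qed.
Lemma EW : E *m W = W.
Proof. by have /(congr1 (@adjmx _ _ _)) := FV; rewrite !adjmxM adjmxK mulmxA. Qed.
Lemma adjE : adjmx E = E. Proof. by rewrite adjmxM adjmxK. Qed.
Lemma adjF : adjmx F = F. Proof. by rewrite adjmxM adjmxK. Qed.

Lemma F12_V23 : leg12 F *m leg23 V = leg23 V *m leg12 F.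
Proof.
by have := mpi_comm1 hV;
  rewrite !(leg12M, leg23M) !(leg12_adj, leg23_adj) !mulmxA.
Qed.

Lemma E23_V12 : leg23 E *m leg12 V = leg12 V *m leg23 E.
Proof.
by have := mpi_comm2 hV;
  rewrite !(leg12M, leg23M) !(leg12_adj, leg23_adj) !mulmxA.
Qed.

Lemma V13_F23 : leg13 V *m leg23 F = leg12 E *m leg13 V.
Proof.
by have := mpi_range hV;
  rewrite !(leg12M, leg23M) !(leg12_adj, leg23_adj) !mulmxA.
Qed.

Lemma F12_W23 : leg12 F *m leg23 W = leg23 W *m leg12 F.
Proof.
have /(congr1 (@adjmx _ _ _)) := F12_V23.
by rewrite !adjmxM -leg12_adj -leg23_adj adjF => ->.
Qed.

Lemma E23_W12 : leg23 E *m leg12 W = leg12 W *m leg23 E.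
Proof.
have /(congr1 (@adjmx _ _ _)) := E23_V12.
by rewrite !adjmxM -leg12_adj -leg23_adj adjE => ->.
Qed.

Lemma E12_E23 : leg12 E *m leg23 E = leg23 E *m leg12 E.
Proof. by rewrite (leg12M W) -mulmxA -E23_V12 mulmxA -E23_W12 mulmxA. Qed.

Lemma F12_F23 : leg12 F *m leg23 F = leg23 F *m leg12 F.
Proof. by rewrite (leg23M V) mulmxA F12_V23 -mulmxA F12_W23 mulmxA. Qed.

(** This is (id (x) Delta)(V) = V12 V13.  The pentagon rewrites V23 V12, after
    which V13 F23 = E12 V13 moves the range projection next to V12. *)
Lemma right_coprod_V : leg23 V *m leg12 V *m leg23 W = leg12 V *m leg13 V.
Proof.
rewrite (mpi_pentagon hV) -mulmxA -leg23M -mulmxA V13_F23 mulmxA -leg12M.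
by rewrite VE.
Qed.

(** This is (hat Delta (x) id)(V) = V13 V23. *)
Lemma left_coprod_V : leg12 W *m leg23 V *m leg12 V = leg13 V *m leg23 V.
Proof.
rewrite -mulmxA (mpi_pentagon hV) !mulmxA -leg12M -V13_F23.
by rewrite -mulmxA -leg23M FV.
Qed.

Lemma right_coprodE w : D (slicel w V) = slice1 w (leg12 V *m leg13 V).
Proof. by rewrite -right_coprod_V slice1_right_coprod. Qed.

Lemma left_coprodE w : Dh (slicer w V) = slicer w (leg13 V *m leg23 V).
Proof. by rewrite -left_coprod_V slicer_left_coprod. Qed.

(** The coproduct of the right leg is the transpose of the multiplication of the
    left leg. *)
Lemma right_dual f g w :
  slice2 f g (D (slicel w V)) = w (slicer f V *m slicer g V).
Proof. by rewrite right_coprodE /slice2 -slice3E slicer_legM. Qed.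

Lemma left_dual f g w :
  slice2 f g (Dh (slicer w V)) = w (slicel f V *m slicel g V).
Proof. by rewrite left_coprodE slice2E slice3E slicel_legM. Qed.

Lemma right_leg_slicel w : A (slicel w V). Proof. by exists w. Qed.
Lemma left_leg_slicer w : Ah (slicer w V). Proof. by exists w. Qed.

Lemma pairing_sym w f : f (slicel w V) = w (slicer f V).
Proof. by rewrite -slice2E. Qed.

(** By duality, the product of two slices is the slice by the convolution of the
    functionals; this is why the legs are closed under multiplication. *)
Lemma right_leg_mul f g : slicel f V *m slicel g V = slicel (slice2 f g \o Dh) V.
Proof. by apply: scalar_eq => w; rewrite pairing_sym -left_dual. Qed.

Lemma left_leg_mul f g : slicer f V *m slicer g V = slicer (slice2 f g \o D) V.
Proof. by apply: scalar_eq => w; rewrite -pairing_sym -right_dual. Qed.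

Lemma right_leg_subalgebra : is_subalgebra A.
Proof.
split=> [|c x y [w _ <-] [w' _ <-]|x y [w _ <-] [w' _ <-]].
- exists \0 => //; apply/matrixP => i j; by rewrite !mxE.
- by exists (comb_scalar c w w') => //; apply/matrixP => i j; rewrite !mxE.
- by rewrite right_leg_mul; apply: right_leg_slicel.
Qed.

Lemma left_leg_subalgebra : is_subalgebra Ah.
Proof.
split=> [|c x y [w _ <-] [w' _ <-]|x y [w _ <-] [w' _ <-]].
- exists \0 => //; apply/matrixP => i j; by rewrite !mxE.
- by exists (comb_scalar c w w') => //; apply/matrixP => i j; rewrite !mxE.
- by rewrite left_leg_mul; apply: left_leg_slicer.
Qed.

Lemma E_right_leg x : A x -> E *m (x *t 1%:M) = (x *t 1%:M) *m E.
Proof.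
case=> w _ <-; rewrite /mpi_lambda -slice1_leg12.
by rewrite -slice1Ml -slice1Mr E23_V12.
Qed.

Lemma F_left_leg x : Ah x -> F *m (1%:M *t x) = (1%:M *t x) *m F.
Proof.
case=> w _ <-; rewrite /mpi_rho -slicer_leg23.
by rewrite -slicerMl -slicerMr -F12_V23.
Qed.

(** V^* V commutes with y (x) 1, so it can be moved to the last V^* and absorbed
    there. *)
Lemma right_coprodM x y : A y -> D (x *m y) = D x *m D y.
Proof.
move=> Ay; rewrite /right_coprod !mulmxA -(mulmxA _ W V) -(mulmxA (V *m _) E).
by rewrite E_right_leg // -!mulmxA (mulmxA W V W) EW (mulmxA (x *t _)) tensmx_mul mulmx1.
Qed.

Lemma left_coprodM x y : Ah y -> Dh (x *m y) = Dh x *m Dh y.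
Proof.
move=> By; rewrite /left_coprod !mulmxA -(mulmxA _ V W) -(mulmxA (W *m _) F).
by rewrite F_left_leg // -!mulmxA (mulmxA V W V) FV (mulmxA (_ *t x)) tensmx_mul mulmx1.
Qed.

(** Both sides are conjugations of x (x) 1 (x) 1, by V12 V13 and by V23 V12; as
    V12 V13 = V23 V12 V23^*, they differ by V23^* V23, which commutes with V12.
    The identity thus holds for every operator x. *)
Lemma right_coassoc x : tensl D (D x) = reassoc (tensr D (D x)).
Proof.
rewrite tensl_right_coprod tensr_right_coprod.
have H : leg13 W *m leg12 W = leg23 V *m leg12 W *m leg23 W.
  have /(congr1 (@adjmx _ _ _)) := right_coprod_V.
  by rewrite !adjmxM -!(leg12_adj, leg23_adj, leg13_adj) adjmxK mulmxA => ->.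
have Hx : leg13 (x *t 1%:M) = leg12 (x *t 1%:M) by rewrite leg13_tens.
have comm23 := leg23_comm1 x W.
rewrite /right_coprod !leg13M !leg12M Hx !mulmxA -(mulmxA _ (leg13 W)) H.
rewrite -right_coprod_V !mulmxA -(mulmxA _ (leg23 W) (leg12 (x *t _))) comm23.
rewrite !mulmxA -(mulmxA _ (leg23 W) (leg23 V)) -leg23M.
by rewrite -(mulmxA _ (leg23 E)) E23_W12 -!mulmxA -leg23M EW.
Qed.

Lemma left_coassoc x : tensl Dh (Dh x) = reassoc (tensr Dh (Dh x)).
Proof.
rewrite tensl_left_coprod tensr_left_coprod.
have H : leg23 W *m leg13 W = leg12 W *m leg23 W *m leg12 V.
  have /(congr1 (@adjmx _ _ _)) := left_coprod_V.
  by rewrite !adjmxM -!(leg12_adj, leg23_adj, leg13_adj) adjmxK mulmxA => ->.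
have Hx : leg13 (1%:M *t x) = leg23 (1%:M *t x) by rewrite leg13_tens leg23_tens.
have comm12 := leg12_comm3 x.
rewrite /left_coprod !leg13M !leg23M Hx !mulmxA H -(mulmxA _ (leg13 V)).
rewrite -left_coprod_V !mulmxA -(mulmxA _ (leg12 V) (leg23 (_ *t x))) comm12.
rewrite !mulmxA -(mulmxA _ (leg12 V) (leg12 W)) -leg12M.
by rewrite -(mulmxA _ (leg12 F)) F12_V23 -!mulmxA -leg12M FV.
Qed.

Lemma tens_set_sum (I : finType) (S : set 'M[C]_n) (c : I -> C)
    (a b : I -> 'M[C]_n) : is_subalgebra S ->
  (forall i, S (a i)) -> (forall i, S (b i)) ->
  tens_set S (\sum_i c i *: (a i *t b i)).
Proof.
move=> hS Sa Sb; exists [seq (c i *: a i, b i) | i <- index_enum I].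
  move=> _ /mapP[i _ ->] /=; split=> //.
  by rewrite -[c i *: a i]addr0; apply: (subalgP hS) => //; apply: subalg0 hS.
rewrite big_map; apply: eq_bigr => i _ /=.
by rewrite -[c i *: a i]addr0 tensmxl_linear tens0mx addr0.
Qed.

(** Expanding V along matrix units of its first leg leaves elements of the right
    leg in the second, so the slice of V12 V13 is a sum of tensors of such
    elements. *)
Lemma right_coprod_sub x : A x -> tens_set A (D x).
Proof.
case=> w _ <-; rewrite /mpi_lambda right_coprodE.
have Ab i j : A (lblock V i j).
  by exists (entry i j) => //; apply/matrixP => k l; rewrite !mxE /= /entry !mxE.
have -> : slice1 w (leg12 V *m leg13 V) =
  \sum_(p : ('I_n * 'I_n) * ('I_n * 'I_n))
     w (delta_mx p.1.1 p.1.2 *m delta_mx p.2.1 p.2.2)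
     *: (lblock V p.1.1 p.1.2 *t lblock V p.2.1 p.2.2).
  rewrite -(pair_bigA _ (fun p q : 'I_n * 'I_n =>
     w (delta_mx p.1 p.2 *m delta_mx q.1 q.2)
     *: (lblock V p.1 p.2 *t lblock V q.1 q.2))) /=.
  rewrite {1}(lblock_sum V) linear_sum mulmx_suml linear_sum; apply: eq_bigr => p _.
  rewrite {2}(lblock_sum V) linear_sum mulmx_sumr linear_sum; apply: eq_bigr => q _.
  by rewrite /= leg13_tens leg12_tens !tensmx_mul mulmx1 mul1mx slice1_tens.
by apply: tens_set_sum => //; apply: right_leg_subalgebra.
Qed.

Lemma left_coprod_sub x : Ah x -> tens_set Ah (Dh x).
Proof.
case=> w _ <-; rewrite /mpi_rho left_coprodE.
have Bb i j : Ah (rblock V i j).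
  by exists (entry i j) => //; apply/matrixP => k l; rewrite !mxE /= /entry !mxE.
have -> : slicer w (leg13 V *m leg23 V) =
  \sum_(p : ('I_n * 'I_n) * ('I_n * 'I_n))
     w (delta_mx p.1.1 p.1.2 *m delta_mx p.2.1 p.2.2)
     *: (rblock V p.1.1 p.1.2 *t rblock V p.2.1 p.2.2).
  rewrite -(pair_bigA _ (fun p q : 'I_n * 'I_n =>
     w (delta_mx p.1 p.2 *m delta_mx q.1 q.2)
     *: (rblock V p.1 p.2 *t rblock V q.1 q.2))) /=.
  rewrite {1}(rblock_sum V) linear_sum mulmx_suml linear_sum; apply: eq_bigr => p _.
  rewrite {2}(rblock_sum V) linear_sum mulmx_sumr linear_sum; apply: eq_bigr => q _.
  by rewrite /= leg13_tens leg23_tens !tensmx_mul mulmx1 mul1mx slicer_tens.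
by apply: tens_set_sum => //; apply: left_leg_subalgebra.
Qed.

(** Applying the counit to one factor of Delta(lambda w) amounts, by duality, to
    multiplying by the unit of the left leg inside w. *)
Lemma right_counit_coalgebra (e : {scalar 'M[C]_n}) :
  is_unit_of Ah (slicer e V) -> is_coalgebra A D e.
Proof.
move=> [_ eU]; split.
- by move=> c x y _ _; rewrite linearP.
- exact: right_coprod_sub.
- by move=> x _; apply: right_coassoc.
- move=> _ [w _ <-]; apply: scalar_eq => f; rewrite -[LHS]/(slice2 e f _) right_dual.
  by rewrite (proj1 (eU _ (left_leg_slicer f))) pairing_sym.
- move=> _ [w _ <-]; apply: scalar_eq => f; rewrite -slice2E right_dual.
  by rewrite (proj2 (eU _ (left_leg_slicer f))) pairing_sym.
Qed.

Lemma left_counit_coalgebra (e : {scalar 'M[C]_n}) :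
  is_unit_of A (slicel e V) -> is_coalgebra Ah Dh e.
Proof.
move=> [_ eU]; split.
- by move=> c x y _ _; rewrite linearP.
- exact: left_coprod_sub.
- by move=> x _; apply: left_coassoc.
- move=> _ [w _ <-]; apply: scalar_eq => f; rewrite -[LHS]/(slice2 e f _) left_dual.
  by rewrite (proj1 (eU _ (right_leg_slicel f))) -pairing_sym.
- move=> _ [w _ <-]; apply: scalar_eq => f; rewrite -slice2E left_dual.
  by rewrite (proj2 (eU _ (right_leg_slicel f))) -pairing_sym.
Qed.

(** * The unital case *)

Section Unital.
Variables e eh : {scalar 'M[C]_n}.
Let u := slicel eh V.
Let uh := slicer e V.
Hypotheses (u_unit : is_unit_of A u) (uh_unit : is_unit_of Ah uh).

Lemma left_absorb (P : 'M[C]_n) :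
  (forall x, Ah x -> P *m x = x) -> (P *t 1%:M) *m V = V.
Proof.
by move=> H; apply: slicer_inj => w;
  rewrite slicerMl (H _ (left_leg_slicer w)).
Qed.

Lemma right_absorb (P : 'M[C]_n) :
  (forall x, A x -> P *m x = x) -> (1%:M *t P) *m V = V.
Proof.
by move=> H; apply: slicel_inj => w;
  rewrite slicelMl (H _ (right_leg_slicel w)).
Qed.

Lemma uh1_V : (uh *t 1%:M) *m V = V.
Proof. by apply: left_absorb => x /(proj2 uh_unit)[]. Qed.

Lemma u2_V : (1%:M *t u) *m V = V.
Proof. by apply: right_absorb => x /(proj2 u_unit)[]. Qed.

Lemma V_u2 : V *m (1%:M *t u) = V.
Proof.
by apply: slicel_inj => w;
  rewrite slicelMr (proj2 (proj2 u_unit _ (right_leg_slicel w))).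
Qed.

Lemma V_uh1 : V *m (uh *t 1%:M) = V.
Proof.
by apply: slicer_inj => w;
  rewrite slicerMr (proj2 (proj2 uh_unit _ (left_leg_slicer w))).
Qed.

(** With V13 F23 = E12 V13 this makes E the slice by e of an operator whose
    first leg starts with V and whose second leg starts with F: the source of
    all absorption properties of E. *)
Lemma E_slice : E = slicer e (leg12 E *m leg13 V).
Proof. by rewrite slicerMl slicer_leg13 -mulmxA V_uh1. Qed.

Lemma F_slice : F = slice1 eh (leg13 V *m leg23 F).
Proof. by rewrite slice1Mr slice1_leg13 mulmxA u2_V. Qed.

Lemma uh1_E : (uh *t 1%:M) *m E = E.
Proof.
rewrite {1}E_slice -V13_F23 -slicerMl -/(leg12 _).
have -> : leg12 (uh *t 1%:M) = leg13 (uh *t 1%:M) by rewrite leg13_tens.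
by rewrite mulmxA -leg13M uh1_V V13_F23 -E_slice.
Qed.

(** The second leg of V13 F23 is the first leg of F = V V^*, on which uh acts
    trivially from the left. *)
Lemma uh2_E : (1%:M *t uh) *m E = E.
Proof.
rewrite {1}E_slice -V13_F23 -slicerMl -/(leg12 _) mulmxA -leg13_comm2.
have -> : leg12 (1%:M *t uh) = leg23 (uh *t 1%:M) by rewrite leg23_tens.
by rewrite -mulmxA -leg23M mulmxA uh1_V V13_F23 -E_slice.
Qed.

Lemma F_u2 : F *m (1%:M *t u) = F.
Proof.
rewrite {1}F_slice V13_F23 -slice1Mr.
have -> : leg23 (1%:M *t u) = leg13 (1%:M *t u) by rewrite leg13_tens leg23_tens.
by rewrite -mulmxA -leg13M V_u2 -V13_F23 -F_slice.
Qed.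

Lemma F_u1 : F *m (u *t 1%:M) = F.
Proof.
rewrite {1}F_slice V13_F23 -slice1Mr.
have -> : leg23 (u *t 1%:M) = leg12 (1%:M *t u) by rewrite leg23_tens.
rewrite -mulmxA leg13_comm2 mulmxA -leg12M -(mulmxA W) V_u2.
by rewrite -V13_F23 -F_slice.
Qed.

(** Since E is self-adjoint, uh E = E on the first leg turns into E uh^* = E,
    hence V uh^* = V; slicing by e gives uh = uh uh^*. *)
Lemma uh_selfadj : adjmx uh = uh.
Proof.
have H : V *m (adjmx uh *t 1%:M) = V.
  have /(congr1 (@adjmx _ _ _)) := uh1_E.
  by rewrite [LHS]adjmxM adjE adjmx_tens adjmx1 => EE; rewrite -{1}VE -mulmxA EE VE.
have H1 : uh *m adjmx uh = uh by rewrite -slicerMr H.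
by rewrite -{1}H1 adjmxM adjmxK H1.
Qed.

Lemma u_selfadj : adjmx u = u.
Proof.
have H : (1%:M *t adjmx u) *m V = V.
  have /(congr1 (@adjmx _ _ _)) := F_u2.
  by rewrite [LHS]adjmxM adjF adjmx_tens adjmx1 => FF; rewrite -{1}FV mulmxA FF FV.
have H1 : adjmx u *m u = u by rewrite -slicelMl H.
by rewrite -{1}H1 adjmxM adjmxK H1.
Qed.

(** V absorbs uh on its second leg from the right and u on its first leg from
    the left; slicing by eh and by e gives u uh = u and u uh = uh. *)
Lemma u_uh : u = uh.
Proof.
have H1 : V *m (1%:M *t uh) = V.
  have /(congr1 (@adjmx _ _ _)) := uh2_E.
  rewrite [LHS]adjmxM adjE adjmx_tens adjmx1 uh_selfadj => EE.
  by rewrite -{1}VE -mulmxA EE VE.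
have H2 : (u *t 1%:M) *m V = V.
  have /(congr1 (@adjmx _ _ _)) := F_u1.
  rewrite [LHS]adjmxM adjF adjmx_tens adjmx1 u_selfadj => FF.
  by rewrite -{1}FV mulmxA FF FV.
transitivity (u *m uh); last by rewrite -slicerMl H2.
by rewrite -slicelMr H1.
Qed.

Lemma right_coprod_unit : D u = F.
Proof. by rewrite /right_coprod u_uh V_uh1. Qed.

Lemma left_coprod_unit : Dh uh = E.
Proof. by rewrite /left_coprod -mulmxA -u_uh u2_V. Qed.

Lemma F_absorbs_u : [/\ F *m (u *t 1%:M) = F, (1%:M *t u) *m F = F,
  (u *t 1%:M) *m F = F & F *m (1%:M *t u) = F].
Proof.
split; [exact: F_u1| |by rewrite u_uh mulmxA uh1_V|exact: F_u2].
by rewrite mulmxA u2_V.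
Qed.

Lemma E_absorbs_uh : [/\ E *m (uh *t 1%:M) = E, (1%:M *t uh) *m E = E,
  (uh *t 1%:M) *m E = E & E *m (1%:M *t uh) = E].
Proof.
split; [by rewrite -mulmxA V_uh1|exact: uh2_E|exact: uh1_E|].
by rewrite -u_uh -mulmxA V_u2.
Qed.

(** * The weak bialgebra axioms *)

Lemma right_coprod2_unit : tensl D (D u) = leg12 F *m leg23 F.
Proof.
rewrite right_coassoc right_coprod_unit tensr_right_coprod -F12_V23.
by rewrite -mulmxA -leg23M.
Qed.

Lemma left_coprod2_unit : tensl Dh (Dh uh) = leg12 E *m leg23 E.
Proof.
rewrite left_coprod_unit tensl_left_coprod -E23_W12 -mulmxA -leg12M.
by rewrite E12_E23.
Qed.

(** e (x y) is the pairing of x (x) y with hat Delta(uh) = E. *)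
Lemma counitM_right f g : e (slicel f V *m slicel g V) = slice2 f g E.
Proof. by rewrite right_leg_mul pairing_sym /= -/uh left_coprod_unit. Qed.

Lemma counitM_left f g : eh (slicer f V *m slicer g V) = slice2 f g F.
Proof. by rewrite left_leg_mul -pairing_sym /= -/u right_coprod_unit. Qed.

(** The next four lemmas compute the images under rho and lambda of the
    functionals e (x _), e (_ x) and eh (x _), eh (_ x), to which [right_dual]
    and [left_dual] reduce the counit axioms. *)
Lemma slicer_counit_mull w : slicer (e \o mulmx (slicel w V)) V = slicel w E.
Proof. by apply: scalar_eq => f; rewrite -pairing_sym /= counitM_right. Qed.

Lemma slicer_counit_mulr w : slicer (e \o mulmxr (slicel w V)) V = slicer w E.
Proof.
by apply: scalar_eq => f;
  rewrite -pairing_sym /= counitM_right slice2E.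
Qed.

Lemma slicel_counit_mull w : slicel (eh \o mulmx (slicer w V)) V = slicel w F.
Proof. by apply: scalar_eq => f; rewrite pairing_sym /= counitM_left. Qed.

Lemma slicel_counit_mulr w : slicel (eh \o mulmxr (slicer w V)) V = slicer w F.
Proof. by apply: scalar_eq => f; rewrite pairing_sym /= counitM_left slice2E. Qed.

Lemma counitMM_right f g h :
  e (slicel f V *m slicel g V *m slicel h V)
   = slice2 f g (slicer h (leg12 E *m leg23 E)).
Proof.
rewrite right_leg_mul counitM_right slice2E /= -slicer_left_coprod -E23_W12 -mulmxA.
by rewrite -leg12M E12_E23.
Qed.

(** The product is associated to the right here: [right_coprod] conjugates the
    second leg of F12, so the first leg must be the one that is sliced. *)
Lemma counitMM_left f g h :
  eh (slicer f V *m slicer g V *m slicer h V)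
   = slice2 g h (slice1 f (leg12 F *m leg23 F)).
Proof.
rewrite -mulmxA left_leg_mul counitM_left {1}/slice2 /= -slice1_right_coprod -F12_V23.
by rewrite -mulmxA -leg23M.
Qed.

Lemma right_weak_bialgebra : is_weak_bialgebra_with A D u e.
Proof.
have [Fu1 u2F u1F Fu2] := F_absorbs_u.
split; [exact: right_leg_subalgebra|exact: u_unit|exact: right_counit_coalgebra| | | | |].
- by move=> x y _ Ay; apply: right_coprodM.
- by rewrite right_coprod2_unit right_coprod_unit unit_legs.
- by rewrite right_coprod2_unit right_coprod_unit unit_legs_rev // F12_F23.
- move=> _ _ _ [f _ <-] [g _ <-] [h _ <-]; rewrite /mpi_lambda counitMM_right.
  rewrite slice2_mul_lr right_dual slicer_counit_mull slicer_counit_mulr.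
  by rewrite slicerMl slicer_leg23 /slice2 slicelMr.
- move=> _ _ _ [f _ <-] [g _ <-] [h _ <-]; rewrite /mpi_lambda counitMM_right.
  rewrite slice2_mul_rl right_dual slicer_counit_mull slicer_counit_mulr.
  by rewrite E12_E23 slicerMr slicer_leg23 /slice2 slicelMl.
Qed.

Lemma left_weak_bialgebra : is_weak_bialgebra_with Ah Dh uh eh.
Proof.
have [Eu1 u2E u1E Eu2] := E_absorbs_uh.
split; [exact: left_leg_subalgebra|exact: uh_unit|exact: left_counit_coalgebra| | | | |].
- by move=> x y _ By; apply: left_coprodM.
- by rewrite left_coprod2_unit left_coprod_unit unit_legs.
- by rewrite left_coprod2_unit left_coprod_unit unit_legs_rev // E12_E23.
- move=> _ _ _ [f _ <-] [g _ <-] [h _ <-]; rewrite /mpi_rho counitMM_left.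
  rewrite slice2_mul_lr left_dual slicel_counit_mull slicel_counit_mulr.
  by rewrite slice1Mr slice1_leg12 slice2E slicerMl.
- move=> _ _ _ [f _ <-] [g _ <-] [h _ <-]; rewrite /mpi_rho counitMM_left.
  rewrite slice2_mul_rl left_dual slicel_counit_mull slicel_counit_mulr.
  by rewrite F12_F23 slice1Ml slice1_leg12 slice2E slicerMr.
Qed.

End Unital.

(** * The canonical pairing *)

(** Evaluates at x any functional f with phi = rho f; for x in the right leg the
    value is independent of the choice of f, by [pairing_sym]. *)
Definition canonical_pairing (x phi : 'M[C]_n) : C :=
  if pselect (Ah phi) is left H then (projT1 (cid2 H)) x else 0.

Lemma canonical_pairingE w f :
  canonical_pairing (slicel w V) (slicer f V) = f (slicel w V).
Proof.
rewrite /canonical_pairing; case: pselect => [H|[]]; last exact: left_leg_slicer.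
by case: cid2 => g /= _ gE; rewrite !pairing_sym; congr (w _).
Qed.

Lemma canonical_pairing_right f x : A x -> canonical_pairing x (slicer f V) = f x.
Proof. by case=> w _ <-; apply: canonical_pairingE. Qed.

Lemma canonical_pairing_left w y : Ah y -> canonical_pairing (slicel w V) y = w y.
Proof. by case=> f _ <-; rewrite canonical_pairingE pairing_sym. Qed.

Lemma canonical_pairingP : is_canonical_pairing V canonical_pairing.
Proof. by move=> w f; apply: canonical_pairingE. Qed.

(** A counit e determines the unit of the left leg: dualizing the counit
    property, rho e is a left unit. *)
Lemma right_counit_unit (e : {scalar 'M[C]_n}) uh :
  is_unit_of Ah uh -> is_coalgebra A D e -> slicer e V = uh.
Proof.
move=> [Buh uh_unit] coA.
have H y : Ah y -> slicer e V *m y = y.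
  case=> f _ <-; apply: scalar_eq => w; rewrite -right_dual.
  by rewrite /slice2 (coalg_counitl coA (right_leg_slicel w)) pairing_sym.
by rewrite -[RHS](H _ Buh) (proj2 (uh_unit _ (left_leg_slicer e))).
Qed.

Lemma left_counit_unit (eh : {scalar 'M[C]_n}) u :
  is_unit_of A u -> is_coalgebra Ah Dh eh -> slicel eh V = u.
Proof.
move=> [Au u_unit] coB.
have H x : A x -> slicel eh V *m x = x.
  case=> f _ <-; apply: scalar_eq => w; rewrite -left_dual.
  by rewrite /slice2 (coalg_counitl coB (left_leg_slicer w)) -pairing_sym.
by rewrite -[RHS](H _ Au) (proj2 (u_unit _ (right_leg_slicel eh))).
Qed.

(** On the legs the pairing is evaluation of a slicing functional in either
    variable, so each duality property is a property of functionals. *)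
Lemma canonical_duality u uh (e eh : {scalar 'M[C]_n}) :
  is_weak_bialgebra_with A D u e -> is_weak_bialgebra_with Ah Dh uh eh ->
  in_duality canonical_pairing A D u e Ah Dh uh eh.
Proof.
move=> wA wB; have [hA hB] := (right_leg_subalgebra, left_leg_subalgebra).
split.
- move=> c x y _ Ax Ay [f _ <-]; rewrite !canonical_pairing_right ?linearP //.
  exact: (subalgP hA).
- move=> c _ y z [w _ <-] By Bz; rewrite !canonical_pairing_left ?linearP //.
  exact: (subalgP hB).
- move=> x Ax H; apply: scalar_eq => f; rewrite linear0.
  by rewrite -(canonical_pairing_right f Ax) H //; apply: left_leg_slicer.
- move=> y By H; apply: scalar_eq => w; rewrite linear0.
  by rewrite -(canonical_pairing_left w By) H //; apply: right_leg_slicel.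
- move=> _ _ _ [w _ <-] [f _ <-] [g _ <-] s sA sE.
  rewrite canonical_pairing_left; last by apply: (subalgM hB); apply: left_leg_slicer.
  rewrite -right_dual sE linear_sum big_seq [RHS]big_seq; apply: eq_bigr => ab.
  move=> /sA[Aa Ab]; rewrite !canonical_pairing_right //.
  by rewrite /= /slice2 slicel_tens linearZ.
- move=> _ _ _ [f _ <-] [g _ <-] [w _ <-] s sB sE.
  rewrite canonical_pairing_right; last by apply: (subalgM hA); apply: right_leg_slicel.
  rewrite -left_dual sE linear_sum big_seq [RHS]big_seq; apply: eq_bigr => ab.
  move=> /sB[Ba Bb]; rewrite !canonical_pairing_left //.
  by rewrite /= /slice2 slicel_tens linearZ.
- move=> _ [w _ <-].
  rewrite canonical_pairing_left; last exact: (proj1 (wb_one wB)).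
  by rewrite [LHS]pairing_sym (right_counit_unit (wb_one wB) (wb_coalg wA)).
- move=> _ [f _ <-].
  rewrite canonical_pairing_right; last exact: (proj1 (wb_one wA)).
  by rewrite -[LHS]pairing_sym (left_counit_unit (wb_one wA) (wb_coalg wB)).
Qed.

End MPI.

Local Open Scope complex_scope.

Theorem mainTheorem3 (R : realType) (n : nat) (V : 'M[R[i]]_(n * n)) (hV : is_MPI V) :
  (is_weak_bialgebra (right_leg V) (right_coprod V) /\
   is_weak_bialgebra (left_leg V) (left_coprod V)
   <-> is_unital V)
  /\
  (forall (u uh : 'M[R[i]]_n) (e eh : {scalar 'M[R[i]]_n}),
     is_weak_bialgebra_with (right_leg V) (right_coprod V) u e ->
     is_weak_bialgebra_with (left_leg V) (left_coprod V) uh eh ->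
     exists2 p : 'M[R[i]]_n -> 'M[R[i]]_n -> R[i],
       is_canonical_pairing V p
       & in_duality p (right_leg V) (right_coprod V) u e
                      (left_leg V) (left_coprod V) uh eh).
Proof.
split; last first.
  move=> u uh e eh wA wB; exists (canonical_pairing V).
    exact: canonical_pairingP.
  exact: canonical_duality.
split=> [[[u [e wA]] [uh [eh wB]]]|[e [eh [u_unit uh_unit]]]].
  exists e, eh; rewrite /mpi_lambda /mpi_rho.
  rewrite (right_counit_unit hV (wb_one wB) (wb_coalg wA)).
  rewrite (left_counit_unit hV (wb_one wA) (wb_coalg wB)).
  by split; [exact: wb_one wA | exact: wb_one wB].
split; [exists (mpi_lambda V eh), e|exists (mpi_rho V e), eh].
  exact: right_weak_bialgebra.
exact: left_weak_bialgebra.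
Qed.
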